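(* Let $\Bbbk$ be a field of characteristic zero, and let $(L,\langle\cdot,\cdot\rangle_L,\alpha_L,\beta_L,\omega_L)$ and $(\mathfrak a,\langle\cdot,\cdot\rangle_{\mathfrak a},\alpha_{\mathfrak a},\beta_{\mathfrak a},\omega_{\mathfrak a})$ be qhl-algebras over $\Bbbk$ with $\mathfrak a$ abelian. Suppose there exists a central extension $(E,\langle\cdot,\cdot\rangle_E,\alpha_E,\beta_E,\omega_E)$ of $L$ by $\mathfrak a$, given by $0\to\mathfrak a\xrightarrow{\iota}E\xrightarrow{\mathrm{pr}}L\to 0$. Then for any section $s:L\to E$ (a $\Bbbk$-linear map with $\mathrm{pr}\circ s=\mathrm{id}_L$) satisfying $$\omega_E\big(s(x)+\iota(a),s(y)+\iota(b)\big)\circ s=s\circ\omega_L(x,y)\qquad(\ast)$$ whenever $(x,y)\in D_{\omega_L}$ and $\big(s(x)+\iota(a),s(y)+\iota(b)\big)\in D_{\omega_E}$ (with $a,b\in\mathfrak a$), there are an $\omega$-alternating bilinear map $g:L\times L\to\mathfrak a$ and linear maps $f:E\to\mathfrak a$ and $h:E\to\mathfrak a$ such that $$f\circ\iota=\alpha_{\mathfrak a},\qquad h\circ\iota=\beta_{\mathfrak a},$$ and also $$g(\alpha_L(x),\alpha_L(y))=h\big(s(\alpha_L\langle x,y\rangle_L)+\iota(f\langle s(x),s(y)\rangle_E)\big)$$ for all $x,y\in L$, and $$\circlearrowleft_{(x,a),(y,b),(z,c)}\ \omega_E\big(s(z)+\iota(c),s(x)+\iota(a)\big)\Big(\iota\big(g(\alpha_L(x),\langle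 y,z\rangle_L)\big)+\iota\Big(h\big(s\langle x,\langle y,z\rangle_L\rangle_L+\iota(g(x,\langle y,z\rangle_L))\big)\Big)\Big)=0\qquad(\ast\ast)$$ for all pairs $(x,a),(y,b),(z,c)\in L\times\mathfrak a$ such that $\big(s(z)+\iota(c),s(x)+\iota(a)\big)$, $\big(s(x)+\iota(a),s(y)+\iota(b)\big)$, $\big(s(y)+\iota(b),s(z)+\iota(c)\big)\in D_{\omega_E}$. Moreover, equation $(\ast\ast)$ is independent of the choice of section $s$ and function $h$, if only sections satisfying $(\ast)$ are considered: if $s$ and $\tilde s$ are two sections satisfying $(\ast)$, and $(g,h)$, $(\tilde g,\tilde h)$ are the maps associated with $s$ and $\tilde s$ respectively (see context), then $(\ast\ast)$ holds for $(s,g,h)$ if and only if it holds for $(\tilde s,\tilde g,\tilde h)$.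
   Context: Throughout, $\Bbbk$ is a field of characteristic zero and $\mathcal L_\Bbbk(V)$ is the space of $\Bbbk$-linear endomorphisms of a $\Bbbk$-linear space $V$. $\circlearrowleft$ denotes summation over cyclic permutations of the indicated variables. Qhl-algebra: a quasi-hom-Lie algebra (qhl-algebra) is a tuple $(L,\langle\cdot,\cdot\rangle_L,\alpha,\beta,\omega)$ where $L$ is a $\Bbbk$-linear space, $\langle\cdot,\cdot\rangle_L:L\times L\to L$ is bilinear, $\alpha,\beta:L\to L$ are linear maps, and $\omega:D_\omega\to\mathcal L_\Bbbk(L)$ is a map with domain $D_\omega\subseteq L\times L$, such that: (1) $\langle\alpha(x),\alpha(y)\rangle_L=\beta\circ\alpha\langle x,y\rangle_L$ for all $x,y\in L$; (2) $\langle x,y\rangle_L=\omega(x,y)\langle y,x\rangle_L$ for all $(x,y)\in D_\omega$; (3) $\circlearrowleft_{x,y,z}\big\{\omega(z,x)\big(\langle\alpha(x),\langle y,z\rangle_L\rangle_L+\beta\langle x,\langle y,z\rangle_L\rangle_L\big)\big\}=0$ for all $(z,x),(x,y),(y,z)\in D_\omega$. A strong morphism $\phi:L\to L'$ of qhl-algebras is a linear map with $\phi(\langle x,y\rangle_L)=\langle\phi(x),\phi(y)\rangle_{L'}$, $\phi\circ\alpha_L=\alpha_{L'}\circ\phi$ and $\phi\circ\beta_L=\beta_{L'}\circ\phi$. Extension: $E$ is an extension of $L$ by $\mathfrak a$ if there is a short exact sequence of linear spaces $0\to\mathfrak a\xrightarrow{\iota}E\xrightarrow{\mathrm{pr}}L\to0$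 in which $\iota$ and $\mathrm{pr}$ are strong morphisms of qhl-algebras and, wherever the $\omega$'s involved are defined, $\iota\circ\omega_{\mathfrak a}(a,b)=\omega_E(\iota(a),\iota(b))\circ\iota$ and $\mathrm{pr}\circ\omega_E(e,e')=\omega_L(\mathrm{pr}(e),\mathrm{pr}(e'))\circ\mathrm{pr}$. The extension is central if $\iota(\mathfrak a)\subseteq Z(E)=\{e\in E\mid\langle e,E\rangle_E=0\}$. Here $\mathfrak a$ abelian means $\langle\mathfrak a,\mathfrak a\rangle_{\mathfrak a}=0$. $\omega$-alternating: a bilinear map $g:L\times L\to\mathfrak a$ is $\omega$-alternating (with respect to the extension and the section $s$) if $\iota(g(x,y))=\omega_E(s(x),s(y))\big(\iota(g(y,x))\big)$ for all $(x,y)\in D_{\omega_L}$ such that $(s(x),s(y))\in D_{\omega_E}$. Maps associated with a section $s$: $g$, $f$ and $h$ are determined by $\langle s(x),s(y)\rangle_E=s\langle x,y\rangle_L+\iota(g(x,y))$, $\alpha_E=s\circ\alpha_L\circ\mathrm{pr}+\iota\circ f$ and $\beta_E=s\circ\beta_L\circ\mathrm{pr}+\iota\circ h$.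
   Formalization: Equation (∗∗) is asserted only when also (z,x), (x,y), (y,z) lie in the domain of ω_L, and ''central'' means ι(a) annihilates E from both sides; with either change dropped, (∗∗) can depend on the section. *)

(* Defs.v *)
From HB Require Import structures.
From mathcomp Require Import all_boot all_order all_algebra.
From mathcomp Require Export sesquilinear.

Set Implicit Arguments.
Unset Strict Implicit.
Unset Printing Implicit Defensive.

Import GRing.Theory.
Local Open Scope ring_scope.

Definition cyclic_sum (T : Type) (V : nmodType) (F : T -> T -> T -> V)
  (x y z : T) : V := F x y z + F y z x + F z x y.

(* The partial map omega : D_omega -> End(L) is encoded by its domain [dom]
   together with a total function whose values outside [dom] are never used:
   every occurrence of [omega x y] below is guarded by [dom x y]. *)
Record qhlAlgebra (k : fieldType) := QhlAlgebra {
  qhl_sort :> lmodType k;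
  bracket : {bilinear qhl_sort -> qhl_sort -> qhl_sort};
  alpha : {linear qhl_sort -> qhl_sort};
  beta : {linear qhl_sort -> qhl_sort};
  dom : qhl_sort -> qhl_sort -> Prop;
  omega : qhl_sort -> qhl_sort -> {linear qhl_sort -> qhl_sort};
  bracket_alpha : forall x y : qhl_sort,
    bracket (alpha x) (alpha y) = beta (alpha (bracket x y));
  bracket_omega : forall x y : qhl_sort, dom x y ->
    bracket x y = omega x y (bracket y x);
  qhl_jacobi : forall x y z : qhl_sort, dom z x -> dom x y -> dom y z ->
    cyclic_sum (fun x y z => omega z x
      (bracket (alpha x) (bracket y z) + beta (bracket x (bracket y z))))
      x y z = 0
}.

Arguments bracket {k q}.
Arguments alpha {k q}.
Arguments beta {k q}.
Arguments dom {k q}.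
Arguments omega {k q}.

Section Extensions.
Variable k : fieldType.
Implicit Types L A E : qhlAlgebra k.

Definition qhl_abelian A : Prop := forall a b : A, bracket a b = 0.

(* The bracket is not globally skew-symmetric, so e is required to annihilate
   E from both sides. *)
Definition qhl_center E (e : E) : Prop :=
  forall e' : E, bracket e e' = 0 /\ bracket e' e = 0.

Record strong_morphism L E (phi : {linear L -> E}) : Prop := StrongMorphism {
  strong_bracket : forall x y, phi (bracket x y) = bracket (phi x) (phi y);
  strong_alpha : forall x, phi (alpha x) = alpha (phi x);
  strong_beta : forall x, phi (beta x) = beta (phi x)
}.

Record extension L A E (iota : {linear A -> E}) (pr : {linear E -> L}) : Prop
  := Extension {
  ext_inj : injective iota;
  ext_exact : forall e, pr e = 0 <-> exists a, iota a = e;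
  ext_surj : forall x, exists e, pr e = x;
  ext_iota : strong_morphism iota;
  ext_pr : strong_morphism pr;
  ext_iota_omega : forall a b, dom a b -> dom (iota a) (iota b) ->
    forall c, iota (omega a b c) = omega (iota a) (iota b) (iota c);
  ext_pr_omega : forall e e', dom e e' -> dom (pr e) (pr e') ->
    forall u, pr (omega e e' u) = omega (pr e) (pr e') (pr u)
}.

Definition central_extension L A E (iota : {linear A -> E})
    (pr : {linear E -> L}) : Prop :=
  extension iota pr /\ forall a, qhl_center (iota a).

Definition qhl_section L E (pr : {linear E -> L}) (s : {linear L -> E}) : Prop
  := forall x, pr (s x) = x.

Definition section_omega L A E (iota : {linear A -> E}) (s : {linear L -> E})
    : Prop :=
  forall (x y : L) (a b : A),
    dom x y -> dom (s x + iota a) (s y + iota b) ->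
    forall z, omega (s x + iota a) (s y + iota b) (s z) = s (omega x y z).

Definition omega_alternating L A E (iota : {linear A -> E})
    (s : {linear L -> E}) (g : {bilinear L -> L -> A}) : Prop :=
  forall x y : L, dom x y -> dom (s x) (s y) ->
    iota (g x y) = omega (s x) (s y) (iota (g y x)).

Definition associated_bracket L A E (iota : {linear A -> E})
    (s : {linear L -> E}) (g : {bilinear L -> L -> A}) : Prop :=
  forall x y : L, bracket (s x) (s y) = s (bracket x y) + iota (g x y).

Definition associated_alpha L A E (iota : {linear A -> E})
    (pr : {linear E -> L}) (s : {linear L -> E}) (f : {linear E -> A}) : Prop :=
  forall e : E, alpha e = s (alpha (pr e)) + iota (f e).

Definition associated_beta L A E (iota : {linear A -> E})
    (pr : {linear E -> L}) (s : {linear L -> E}) (h : {linear E -> A}) : Prop :=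
  forall e : E, beta e = s (beta (pr e)) + iota (h e).

(* The conditions on the L-components are automatic when pr maps the domain of
   omega_E into that of omega_L. Where they fail, neither [section_omega] nor
   the Jacobi identity of L applies, and the identity can be false. *)
Definition cocycle_identity L A E (iota : {linear A -> E})
    (s : {linear L -> E}) (g : {bilinear L -> L -> A}) (h : {linear E -> A})
    : Prop :=
  forall p q r : L * A,
    let sec (u : L * A) : E := s u.1 + iota u.2 in
    dom (sec r) (sec p) -> dom (sec p) (sec q) -> dom (sec q) (sec r) ->
    dom r.1 p.1 -> dom p.1 q.1 -> dom q.1 r.1 ->
    cyclic_sum (fun u v w : L * A => omega (sec w) (sec u)
      (iota (g (alpha u.1) (bracket v.1 w.1)) +
       iota (h (s (bracket u.1 (bracket v.1 w.1)) +
                iota (g u.1 (bracket v.1 w.1)))))) p q r = 0.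

End Extensions.

(* Main.v *)
(* By centrality the bracket of E only sees the L-components of its arguments,
   so the axioms of E, evaluated on elements s x + iota a, split into the image
   under s of the corresponding axiom of L and an iota-part, which is the
   asserted identity. Since the cocycle identity thus holds for every section
   satisfying [section_omega], its independence of the section is immediate. *)
From HB Require Import structures.
Require Import Defs.
From mathcomp Require Import all_boot all_order all_algebra.

Set Implicit Arguments.
Unset Strict Implicit.
Unset Printing Implicit Defensive.

Import GRing.Theory.
Local Open Scope ring_scope.

(** Bundles as a bilinear map the composite from which the cocycle [g] is obtained. *)
Lemma exists_bilinear_comp (k : fieldType) (U V W X Y : lmodType k)
    (s : {linear U -> W}) (t : {linear V -> X})
    (b : {bilinear W -> X -> Y}) (Z : lmodType k) (r : {linear Y -> Z}) :
  exists g : {bilinear U -> V -> Z}, forall x y, g x y = r (b (s x) (t y)).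
Proof.
pose g x y := r (b (s x) (t y)).
have gP : bilinear_for *:%R *:%R g.
  split=> [y|x] c u v; first by rewrite /g linearP linearPl linearP.
  by rewrite /g linearP linearPr linearP.
pose mg := bilinear_isBilinear.Build k U V Z *:%R *:%R g gP.
pose G : {bilinear U -> V -> Z} := HB.pack g mg.
by exists G.
Qed.

Section CentralExtension.
Variables (k : fieldType) (L A E : qhlAlgebra k).
Variables (iota : {linear A -> E}) (pr : {linear E -> L}).
Hypothesis E_central : central_extension iota pr.

Let Eext : extension iota pr := proj1 E_central.

Lemma bracket_iotal (a : A) (e : E) : bracket (iota a) e = 0.
Proof. by case: (proj2 E_central a e). Qed.

Lemma bracket_iotar (e : E) (a : A) : bracket e (iota a) = 0.
Proof. by case: (proj2 E_central a e). Qed.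

Lemma bracket_add_iota (e e' : E) (a b : A) :
  bracket (e + iota a) (e' + iota b) = bracket e e'.
Proof.
by rewrite linearDl /= linearDr /= !bracket_iotar bracket_iotal !addr0.
Qed.

Lemma pr_iota (a : A) : pr (iota a) = 0.
Proof. by apply/(ext_exact Eext); exists a. Qed.

Section LinearSection.
Variable s : {linear L -> E}.
Hypothesis s_section : qhl_section pr s.

Lemma sub_section_in_iota (e : E) : exists a, iota a = e - s (pr e).
Proof. by apply/(ext_exact Eext); rewrite linearB /= s_section subrr. Qed.

(** The difference [e - s (pr e)] lies in the kernel of [pr], which is the image of [iota]. By
    injectivity of [iota] its preimage is unique, hence depends linearly on [e]. *)
Lemma exists_retraction :
  exists r : {linear E -> A}, forall e, iota (r e) = e - s (pr e).
Proof.
(* The boolean equality lets [xchoose] pick the preimage constructively. *)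
have ex e : exists a, iota a == e - s (pr e).
  by have [a ea] := sub_section_in_iota e; exists a; rewrite ea.
pose r e := xchoose (ex e).
have rE e : iota (r e) = e - s (pr e) by apply/eqP/(xchooseP (ex e)).
have r_lin : linear r.
  move=> c u v; apply: (ext_inj Eext).
  by rewrite linearP !rE (linearP pr) (linearP s) scalerBr opprD addrACA.
pose mr := GRing.isLinear.Build k E A *:%R r r_lin.
pose f : {linear E -> A} := HB.pack r mr.
by exists f.
Qed.

(** Both [alpha (s x + iota a)] and [s (alpha x)] lie over [alpha x], since [pr] commutes with
    [alpha] and kills [iota a]. Inside a bracket the correction [iota b] then vanishes. *)
Lemma alpha_section_in_iota (x : L) (a : A) :
  exists b, alpha (s x + iota a) = s (alpha x) + iota b.
Proof.
have [b eb] := sub_section_in_iota (alpha (s x + iota a)).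
exists b; rewrite eb (strong_alpha (ext_pr Eext)) (linearD pr) s_section.
by rewrite pr_iota addr0 [RHS]addrC subrK.
Qed.

Variable g : {bilinear L -> L -> A}.
Hypothesis bracket_s : associated_bracket iota s g.

Lemma pr_bracket_section (x y : L) : pr (bracket (s x) (s y)) = bracket x y.
Proof. by rewrite (strong_bracket (ext_pr Eext)) !s_section. Qed.

(** Skew-symmetry in [E] at [(s x, s y)] minus the image under [s] of skew-symmetry in [L] leaves
    the claim. *)
Lemma omega_alternating_of_section :
  section_omega iota s -> omega_alternating iota s g.
Proof.
move=> s_omega x y Dxy Dsxy.
have := @s_omega x y 0 0 Dxy; rewrite linear0 !addr0 => /(_ Dsxy) s_om.
have := bracket_omega Dsxy.
rewrite !bracket_s linearD /= s_om -(bracket_omega Dxy).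
exact: addrI.
Qed.

Variable h : {linear E -> A}.
Hypothesis beta_s : associated_beta iota pr s h.

(** Compares the [iota]-parts of the axiom [bracket_alpha] of [E] at [s x] and [s y]; the argument
    of [h] is [alpha (bracket (s x) (s y))] written out. *)
Lemma cocycle_bracket_alpha (f : {linear E -> A}) (x y : L) :
  associated_alpha iota pr s f ->
  g (alpha x) (alpha y) =
    h (s (alpha (bracket x y)) + iota (f (bracket (s x) (s y)))).
Proof.
move=> alpha_s; apply: (ext_inj Eext).
have alpha_xy := alpha_s (bracket (s x) (s y)).
have := bracket_alpha (s x) (s y).
rewrite pr_bracket_section in alpha_xy; rewrite -alpha_xy beta_s.
rewrite (strong_alpha (ext_pr Eext)) pr_bracket_section -bracket_alpha.
rewrite (alpha_s (s x)) (alpha_s (s y)) !s_section bracket_add_iota bracket_s.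
exact: addrI.
Qed.

Lemma cocycle_identity_of_section :
  section_omega iota s -> cocycle_identity iota s g h.
Proof.
move=> s_omega p q r /= Drp Dpq Dqr Lrp Lpq Lqr.
pose sec (u : L * A) := s u.1 + iota u.2.
have bracket_sec u v : bracket (sec u) (sec v)
    = s (bracket u.1 v.1) + iota (g u.1 v.1).
  by rewrite bracket_add_iota bracket_s.
(* Each Jacobi summand of [E] is [s] of the matching summand of [L] plus a summand of the cocycle
   identity. *)
have jacobi_term u v w : dom w.1 u.1 -> dom (sec w) (sec u) ->
    omega (sec w) (sec u) (bracket (alpha (sec u)) (bracket (sec v) (sec w)) +
      beta (bracket (sec u) (bracket (sec v) (sec w)))) =
    s (omega w.1 u.1 (bracket (alpha u.1) (bracket v.1 w.1) +
      beta (bracket u.1 (bracket v.1 w.1)))) +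
    omega (sec w) (sec u)
      (iota (g (alpha u.1) (bracket v.1 w.1)) +
       iota (h (s (bracket u.1 (bracket v.1 w.1)) +
                iota (g u.1 (bracket v.1 w.1))))).
  move=> Lwu Dwu; have [b alpha_u] := alpha_section_in_iota u.1 u.2.
  (* Read backwards, [section_omega] puts both terms under the same operator of [E], so only its
     arguments remain to be compared. *)
  rewrite -(s_omega _ _ _ _ Lwu Dwu) -(linearD (omega _ _)).
  congr (omega _ _ _).
  rewrite (bracket_sec v w) alpha_u !bracket_add_iota !bracket_s beta_s.
  by rewrite (linearD pr) s_section pr_iota addr0 (linearD s) addrACA.
have := qhl_jacobi Drp Dpq Dqr; have := congr1 s (qhl_jacobi Lrp Lpq Lqr).
rewrite /cyclic_sum linear0 2!(linearD s) /=.
rewrite (jacobi_term p q r) // (jacobi_term q r p) // (jacobi_term r p q) //.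
(* The three [s]-terms add up to the image of the Jacobi sum of [L], which is zero. *)
set a1 := s _; set a2 := s _; set a3 := s _ => a0.
by rewrite [a1 + _ + (a2 + _)]addrACA [_ + (a3 + _)]addrACA a0 add0r.
Qed.

End LinearSection.
End CentralExtension.

Theorem theorem7 (k : fieldType) (char_k : [pchar k] =i pred0)
    (L A E : qhlAlgebra k) (A_abelian : qhl_abelian A)
    (iota : {linear A -> E}) (pr : {linear E -> L})
    (E_central : central_extension iota pr) :
  (forall s : {linear L -> E}, qhl_section pr s -> section_omega iota s ->
    exists (g : {bilinear L -> L -> A}) (f h : {linear E -> A}),
      (associated_bracket iota s g /\ associated_alpha iota pr s f /\
       associated_beta iota pr s h) /\
      omega_alternating iota s g /\
      (forall a : A, f (iota a) = alpha a) /\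
      (forall a : A, h (iota a) = beta a) /\
      (forall x y : L,
         g (alpha x) (alpha y) =
         h (s (alpha (bracket x y)) + iota (f (bracket (s x) (s y))))) /\
      cocycle_identity iota s g h) /\
  (forall (s s' : {linear L -> E}) (g g' : {bilinear L -> L -> A})
      (h h' : {linear E -> A}),
    qhl_section pr s -> section_omega iota s ->
    qhl_section pr s' -> section_omega iota s' ->
    associated_bracket iota s g -> associated_beta iota pr s h ->
    associated_bracket iota s' g' -> associated_beta iota pr s' h' ->
    (cocycle_identity iota s g h <-> cocycle_identity iota s' g' h')).

Proof.
split=> [s s_sec s_om | s s' g g' h h' s_sec s_om s'_sec s'_om sg sh s'g sh'].
  (* The maps [g], [f] and [h] are the components along [r] of the bracket, [alpha] and [beta] of
     [E]. *)
  have [r rE] := exists_retraction E_central s_sec.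
  have [g gE] := exists_bilinear_comp s s bracket r.
  have Eext := proj1 E_central.
  have sg : associated_bracket iota s g.
    by move=> x y; rewrite gE rE (pr_bracket_section E_central) // addrC subrK.
  pose f : {linear E -> A} := r \o alpha; pose h : {linear E -> A} := r \o beta.
  have sf : associated_alpha iota pr s f.
    by move=> e; rewrite /f /= rE (strong_alpha (ext_pr Eext)) addrC subrK.
  have sh : associated_beta iota pr s h.
    by move=> e; rewrite /h /= rE (strong_beta (ext_pr Eext)) addrC subrK.
  (* As [iota] commutes with [alpha] and [beta], this left inverse property gives the values of [f]
     and [h] on [iota a]. *)
  have r_iota a : r (iota a) = a.
    apply: (ext_inj Eext).
    by rewrite rE (pr_iota E_central) linear0 subr0.
  exists g, f, h; do !split=> //.
  - exact: (omega_alternating_of_section sg).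
  - by move=> a; rewrite /f /= -(strong_alpha (ext_iota Eext)) r_iota.
  - by move=> a; rewrite /h /= -(strong_beta (ext_iota Eext)) r_iota.
  - by move=> x y; apply: (cocycle_bracket_alpha E_central s_sec sg sh).
  - exact: (cocycle_identity_of_section E_central s_sec sg sh s_om).
split=> _; first exact: (cocycle_identity_of_section E_central s'_sec s'g sh').
exact: (cocycle_identity_of_section E_central s_sec sg sh).
Qed.
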